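(* Let $D$ and $M$ be groups, with $D$ acting on $M$ on the right by automorphisms, $m\mapsto m(d)$ for $m\in M$, $d\in D$, and let $j:D\to M$ be a crossed homomorphism. Let $K$ be an abelian (additive) group on which $D$ also acts on the right by automorphisms, and let $c:M\times M\to K$ be a central 2-cocycle on $M$. If $c$ is $D$-invariant, i.e. $$c(m_1,m_2)(d)=c(m_1(d),m_2(d))\quad\text{for all } m_1,m_2\in M,\ d\in D,$$ then $$b(d_1,d_2)=c\bigl(j(d_1)(d_2),\,j(d_2)\bigr),\qquad d_1,d_2\in D,$$ defines an abelian $K$-valued 2-cocycle on $D$.
   Context: Right action means $m(d_1d_2)=(m(d_1))(d_2)$, and similarly for $K$; the action on $K$ is written $k\mapsto k(d)$. A crossed homomorphism is a map $j:D\to M$ such that $j(d_1d_2)=j(d_1)(d_2)\cdot j(d_2)$ for all $d_1,d_2\in D$, where $j(d_1)(d_2)$ denotes the result of acting by $d_2$ on $j(d_1)\in M$. A central $K$-valued 2-cocycle on $M$ is a map $c:M\times M\to K$ satisfying $$c(m_1,m_2)+c(m_1m_2,m_3)=c(m_1,m_2m_3)+c(m_2,m_3)\quad\text{for all } m_1,m_2,m_3\in M.$$ An abelian $K$-valued 2-cocycle on $D$ is a map $b:D\times D\to K$ satisfying $$b(d_1,d_2)(d_3)+b(d_1d_2,d_3)=b(d_1,d_2d_3)+b(d_2,d_3)\quad\text{for all } d_1,d_2,d_3\in D.$$ *)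

(* Defs.v *)
From HB Require Import structures.
From mathcomp Require Import all_boot all_algebra.

Set Implicit Arguments.
Unset Strict Implicit.
Unset Printing Implicit Defensive.

(* The actions of fingroup/action.v require a finite acting group; here the   *)
(* acting group is an arbitrary groupType. In all definitions below [act x d] *)
(* is the result x(d) of acting by d on x.                                    *)

Definition is_right_action (D : groupType) (T : Type) (act : T -> D -> T) :=
  (forall x, act x 1%g = x) /\
  (forall x d1 d2, act x (d1 * d2)%g = act (act x d1) d2).

Definition group_automorphism (M : groupType) (f : M -> M) :=
  bijective f /\ {morph f : x y / (x * y)%g}.

Definition zmod_automorphism (K : zmodType) (f : K -> K) :=
  bijective f /\ {morph f : x y / (x + y)%R}.

Definition acts_by_group_automorphisms (D M : groupType) (act : M -> D -> M) :=
  is_right_action act /\ (forall d, group_automorphism (act^~ d)).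

Definition acts_by_zmod_automorphisms (D : groupType) (K : zmodType)
    (act : K -> D -> K) :=
  is_right_action act /\ (forall d, zmod_automorphism (act^~ d)).

Definition crossed_homomorphism (D M : groupType) (act : M -> D -> M)
    (j : D -> M) :=
  forall d1 d2, j (d1 * d2)%g = (act (j d1) d2 * j d2)%g.

Definition central_2cocycle (M : groupType) (K : zmodType) (c : M -> M -> K) :=
  forall m1 m2 m3,
    (c m1 m2 + c (m1 * m2)%g m3 = c m1 (m2 * m3)%g + c m2 m3)%R.

Definition abelian_2cocycle (D : groupType) (K : zmodType) (act : K -> D -> K)
    (b : D -> D -> K) :=
  forall d1 d2 d3,
    (act (b d1 d2) d3 + b (d1 * d2)%g d3 = b d1 (d2 * d3)%g + b d2 d3)%R.

(* Main.v *)
Require Import Defs.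
From HB Require Import structures.
From mathcomp Require Import all_boot all_algebra.

(* The claim is the cocycle identity of [c] at the triple
   (j(d1)(d2 d3), j(d2)(d3), j(d3)). *)

Theorem lemma3p1 (D M : groupType) (K : zmodType)
    (actM : M -> D -> M) (actK : K -> D -> K) (j : D -> M) (c : M -> M -> K)
    (hactM : acts_by_group_automorphisms actM)
    (hactK : acts_by_zmod_automorphisms actK)
    (hj : crossed_homomorphism actM j)
    (hc : central_2cocycle c)
    (hinv : forall (m1 m2 : M) (d : D),
       actK (c m1 m2) d = c (actM m1 d) (actM m2 d)) :
  abelian_2cocycle actK (fun d1 d2 : D => c (actM (j d1) d2) (j d2)).
Proof.
case: hactM => [[_ actMM] autM] d1 d2 d3.
have [_ actM_mul] := autM d3.
(* Write [m1], [m2], [m3] for the triple. Invariance moves [d3] inside [c], so the twisted term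
   becomes [c m1 m2]. The crossed rule gives [j (d2 * d3) = m2 * m3] and, since [d3] acts
   multiplicatively, [actM (j (d1 * d2)) d3 = m1 * m2]. Folding the iterated action on [j d1] makes
   both forms of [m1] agree. *)
by rewrite hinv !hj actM_mul -!actMM hc.
Qed.
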